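(* Let $d\ge 4$ be an even integer and suppose that $d=r+s$ with $r=s$. Suppose that $\alpha\neq\beta$ in $\mathbb{T}$ satisfy Condition (P) (with respect to $r,s$). Let $d_0:=\frac d2$, $V:=\alpha I_r\oplus\beta I_s\in\mathcal{U}(\mathbb{C}^d)$, $\mathcal{H}_1=\ker(V-\alpha I_d)$ and $\mathcal{H}_2=\ker(V-\beta I_d)$. Then $V\in\mathrm{Sym}_3(\mathbb{C}^d)$ with a factorisation $V=J_1J_2J$ into symmetries, $J$ balanced, such that $\dim\mathcal{M}_1=0=\dim\mathcal{M}_2$ in the standard decomposition of $J$ relative to $\mathbb{C}^d=\mathcal{H}_1\oplus\mathcal{H}_2$, if and only if one of the following three conditions holds: (a) $d$ is divisible by $4$, $(\alpha\beta)^{d_0}=-1$, and $|(\alpha\beta)^{2j-1}-1|<|\alpha-\beta|$ for all $1\le j\le d_0$; (b) $d$ is not divisible by $4$, and $|(\alpha\beta)^{2j-1}-1|<|\alpha-\beta|$ for all $1\le j\le d_0$; or (c) $d$ is not divisible by $4$, $(-\alpha\beta)^{d_0}=1$, and $|e^{i\frac{d_0-1}{d_0}\pi}-1|<|\alpha-\beta|$.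
   Context: $\mathbb{T}=\{z\in\mathbb{C}:|z|=1\}$; $\mathcal{U}(\mathbb{C}^d)$ is the group of unitary $d\times d$ matrices. A symmetry on $\mathbb{C}^d$ is an operator $J$ with $J=J^*=J^{-1}$; it is balanced if $\mathrm{tr}(J)\in\{0,1\}$. $\mathrm{Sym}_k(\mathbb{C}^d)$ is the set of all products of $k$ symmetries on $\mathbb{C}^d$. Condition (P): for $d=r+s$ with integers $1\le s\le r$, the numbers $\alpha\ne\beta\in\mathbb{T}$ satisfy Condition (P) if (i) $\alpha^r\beta^s\in\{-1,1\}$, and (ii) whenever $i,j\ge 0$ are integers, not both zero, with $\alpha^i\beta^j\in\{-1,1\}$, then $i+j\ge d$. (In particular $\alpha,\beta\notin\{-1,1\}$.) Standard decomposition: let $J$ be a symmetry on $\mathcal{H}_1\oplus\mathcal{H}_2$ with block form $\begin{bmatrix} A_1 & A_2 \\ A_2^* & A_4 \end{bmatrix}$. Put $\mathcal{M}_1=\mathrm{span}\{\ker(A_1-I),\ker(A_1+I)\}\subseteq\mathcal{H}_1$, $\mathcal{M}_2=\mathrm{span}\{\ker(A_4-I),\ker(A_4+I)\}\subseteq\mathcal{H}_2$, and $\mathcal{N}_k=\mathcal{H}_k\ominus\mathcal{M}_k$. Then $J$ is block diagonal with respect to $\mathcal{M}_1\oplus(\mathcal{N}_1\oplus\mathcal{N}_2)\oplus\mathcal{M}_2$; this is the standard decomposition of $J$ relative to $\mathcal{H}_1\oplus\mathcal{H}_2$. *)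

(* Defs.v *)
From HB Require Import structures.
From mathcomp Require Export all_boot all_order all_algebra.
From mathcomp Require Export sesquilinear spectral.
From mathcomp Require Export reals trigo.
From mathcomp Require Export complex.

Set Implicit Arguments.
Unset Strict Implicit.
Unset Printing Implicit Defensive.

Import Order.TTheory GRing.Theory Num.Theory.
Local Open Scope ring_scope.
Local Open Scope sesquilinear_scope.

Definition expi (R : realType) (t : R) : R[i] := Complex (cos t) (sin t).

(* Operators on C^n are matrices acting on column vectors.  [invmx] is the
   identity on singular matrices, hence the explicit invertibility. *)
Definition symmetry (R : realType) (n : nat) (J : 'M[R[i]]_n) : Prop :=
  [/\ J \in unitmx, J = J ^t* & J = invmx J].

Definition balanced (R : realType) (n : nat) (J : 'M[R[i]]_n) : Prop :=
  \tr J = 0 \/ \tr J = 1.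

Definition Sym (R : realType) (k n : nat) (V : 'M[R[i]]_n) : Prop :=
  exists J : 'I_k -> 'M[R[i]]_n,
    (forall i, symmetry (J i)) /\ V = \big[mulmx/1%:M]_(i < k) J i.

Record conditionP (R : realType) (r s : nat) (alpha beta : R[i]) : Prop :=
  ConditionP {
    condP_dims : (1 <= s <= r)%N;
    condP_alpha : `|alpha| = 1;
    condP_beta : `|beta| = 1;
    condP_neq : alpha <> beta;
    condP_det : alpha ^+ r * beta ^+ s = -1 \/ alpha ^+ r * beta ^+ s = 1;
    condP_min : forall i j : nat, ~ (i = 0%N /\ j = 0%N) ->
      alpha ^+ i * beta ^+ j = -1 \/ alpha ^+ i * beta ^+ j = 1 ->
      (r + s <= i + j)%N }.

(* Subspaces of C^n are encoded, as in mxalgebra, by row spaces: the column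
   vector x lies in the subspace H iff (x^T <= H)%MS.  Since [kermx] is the left
   kernel, {x | A x = 0} is encoded by the kernel of the transpose. *)
Definition ker (R : realType) (n : nat) (A : 'M[R[i]]_n) : 'M[R[i]]_n :=
  kermx A^T.

(* [proj_ortho H] acts on row vectors; its transpose is the orthogonal
   projection of C^n onto H acting on column vectors. *)
Definition orthproj (R : realType) (n : nat) (H : 'M[R[i]]_n) : 'M[R[i]]_n :=
  (proj_ortho H)^T.

(* The diagonal block of J on H, as an operator of C^n vanishing on the
   orthogonal complement of H. *)
Definition compression (R : realType) (n : nat) (H J : 'M[R[i]]_n) :
    'M[R[i]]_n :=
  orthproj H *m J *m orthproj H.

(* The summand M_k of the standard decomposition of J, for H = H_k: the
   kernels of A - I and A + I are taken inside H, A being the diagonal block of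
   J on H. *)
Definition std_M (R : realType) (n : nat) (H J : 'M[R[i]]_n) : 'M[R[i]]_n :=
  let A := compression H J in
  let K1 := ker (A - 1%:M) in
  let K2 := ker (A + 1%:M) in
  ((H :&: K1) + (H :&: K2))%MS.

(* Main.v *)
Require Import Defs.
From mathcomp Require Import all_boot all_order all_algebra.
From mathcomp Require Import sesquilinear spectral reals trigo complex.
From mathcomp Require Import separable ring zify.

Set Implicit Arguments.
Unset Strict Implicit.
Unset Printing Implicit Defensive.

Import Order.TTheory GRing.Theory Num.Theory.
Local Open Scope ring_scope.
Local Open Scope sesquilinear_scope.

(** Write g = - alpha beta and E = 1 (+) -1, so that V is a combination of 1
and E.  Since V = J1 J2 J iff W := V J = J1 J2, everything is about the spectrum
of the unitary W, a product of two symmetries.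

If M1 = M2 = 0, then T = E J - J E is injective.  As T anticommutes with E and
J, it yields a similarity S W = g W S, so the spectrum of W is stable under
y |-> g y; conjugation by J1 makes it stable under y |-> 1/y.  Moreover
W + g W^-1 is a multiple of K = E J + J E, and K^2 + T T^* = 4, whence
|y + g/y| < |alpha - beta| <= 2 for every eigenvalue y.  By Condition (P),
g^d0 = 1 or -1 and no smaller power of g is 1 or -1.  If g^d0 = -1, the spectrum
consists of the d-th roots of unity, that is of the powers of g.  If g^d0 = 1,
then d0 is odd and the spectrum contains y g^k for all k, so the bound holds for
|z + 1| with z any d0-th root of y^d; the extremal choice is y^d = -1.

Conversely, given y_j such that the y_j and g/y_j exhaust the roots of
z^d = 1 (resp. -1), the symmetry J with blocks diag(c), diag(s), diag(s),
diag(-c), where c_j = (y_j + g/y_j) / (alpha - beta), gives a W with simple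
spectrum stable under conjugation; the permutation exchanging conjugate
eigenvectors is the symmetry J1. *)

(** * Conjugate transposes and the Hermitian form on row vectors *)

Section Matrices.
Variable C : numClosedFieldType.

Lemma tCmxM m n p (A : 'M[C]_(m, n)) (B : 'M[C]_(n, p)) :
  (A *m B)^t* = B^t* *m A^t*.
Proof. by rewrite trmx_mul map_mxM. Qed.

Lemma tCmxB m n (A B : 'M[C]_(m, n)) : (A - B)^t* = A^t* - B^t*.
Proof. by rewrite linearB /= map_mxB. Qed.

Lemma tCmxD m n (A B : 'M[C]_(m, n)) : (A + B)^t* = A^t* + B^t*.
Proof. by rewrite linearD /= map_mxD. Qed.

Lemma tCmxZ m n (c : C) (A : 'M[C]_(m, n)) : (c *: A)^t* = c^* *: A^t*.
Proof. by rewrite linearZ /= map_mxZ. Qed.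

Lemma mulmx_tC_gt0 n (v : 'rV[C]_n) : v != 0 -> 0 < (v *m v^t*) 0 0.
Proof.
move=> v0; have ge0 i : true -> 0 <= v 0 i * (v^t*) i 0.
  by rewrite !mxE mul_conjC_ge0.
rewrite lt_def mxE sumr_ge0 // andbT; apply: contra v0.
rewrite psumr_eq0 // => /allP v0; apply/eqP/rowP => i; rewrite mxE.
have := v0 i; rewrite mem_index_enum !mxE => /(_ isT).
by rewrite mul_conjC_eq0 => /eqP.
Qed.

Lemma unitarymx_eigen_norm n (W : 'M[C]_n) (v : 'rV_n) y :
  W *m W^t* = 1%:M -> v *m W = y *: v -> v != 0 -> `|y| = 1.
Proof.
move=> WW vW v0; have := mulmx_tC_gt0 v0; set q := (v *m _) 0 0 => q0.
have : (v *m W *m (v *m W)^t*) 0 0 = q.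
  by rewrite tCmxM mulmxA -(mulmxA v) WW mulmx1.
rewrite vW tCmxZ -scalemxAl -scalemxAr scalerA mxE -/q -normCK.
rewrite -{2}(mul1r q) => /(mulIf (lt0r_neq0 q0)) /eqP.
by rewrite sqrp_eq1 // => /eqP.
Qed.

End Matrices.

(** * Commutator and anticommutator of two involutions *)

Section TwoSymmetries.
Variables (C : numClosedFieldType) (n : nat) (E J : 'M[C]_n).
Hypotheses (EE : E *m E = 1%:M) (JJ : J *m J = 1%:M).

Let T := E *m J - J *m E.
Let K := E *m J + J *m E.

Lemma commutator_anti : T *m J = - (J *m T).
Proof.
by rewrite /T mulmxBl mulmxBr -mulmxA JJ !mulmxA JJ mulmx1 mul1mx opprB.
Qed.

Lemma commutator_antil : T *m E = - (E *m T).
Proof.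
by rewrite /T mulmxBl mulmxBr -(mulmxA J) EE !mulmxA EE mulmx1 mul1mx opprB.
Qed.

Lemma anticommutator_comm : K *m E = E *m K.
Proof.
by rewrite /K mulmxDl mulmxDr -(mulmxA J) EE !mulmxA EE mulmx1 mul1mx addrC.
Qed.

(** The products A = E J and B = J E are mutually inverse, so (A + B)^2 - (A - B)^2 = 2 (A B + B A)
    = 4. *)
Lemma anticommutator_sqr : K *m K = T *m T + 4%:M.
Proof.
have h (A B : 'M[C]_n) : (A + B) *m (A + B) =
    (A - B) *m (A - B) + (A *m B + B *m A) *+ 2.
  rewrite !mulmxDl !mulmxDr !mulmxN !mulNmx opprK.
  set a := A *m A; set b := A *m B; set c := B *m A; set e := B *m B.
  apply/matrixP => i j; rewrite mulr2n !mxE; ring.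
rewrite /K /T h; congr (_ + _).
rewrite -(mulmxA E) (mulmxA J J) JJ mul1mx EE.
rewrite -(mulmxA J) (mulmxA E E) EE mul1mx JJ.
by apply/matrixP => i j; rewrite mulr2n !mxE; case: (i == j);
  rewrite ?mulr1n ?mulr0n; ring.
Qed.

Hypotheses (Eh : E^t* = E) (Jh : J^t* = J).
Hypothesis Tinj : forall v : 'rV_n, v *m T = 0 -> v = 0.

(** [K] is Hermitian and [T] skew-Hermitian, so [anticommutator_sqr] gives |v K|^2 = 4 |v|^2 - |v
    T|^2, where the last term is positive by injectivity of [T]. *)
Lemma anticommutator_eigen_lt (v : 'rV_n) (mu : C) :
  v *m K = (2 * mu) *: v -> v != 0 -> `|mu| < 1.
Proof.
move=> vK v0; have q0 := mulmx_tC_gt0 v0.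
have vT0 : v *m T != 0 by apply: contra v0 => /eqP /Tinj ->.
have r0 := mulmx_tC_gt0 vT0.
have Kh : K^t* = K by rewrite /K tCmxD !tCmxM Eh Jh addrC.
have Th : T^t* = - T by rewrite /T tCmxB !tCmxM Eh Jh opprB.
have : ((v *m K) *m (v *m K)^t*) = 4 *: (v *m v^t*) - (v *m T) *m (v *m T)^t*.
  rewrite !tCmxM Kh Th !mulmxA mulmxN mulNmx opprK -(mulmxA v) anticommutator_sqr.
  by rewrite mulmxDr mul_mx_scalar mulmxDl -scalemxAl mulmxA addrC.
rewrite vK tCmxZ -scalemxAl -scalemxAr scalerA.
move: q0 r0; move: (v *m _) (v *m T *m _) => q r q0 r0 /matrixP /(_ 0 0).
rewrite !mxE => e; have : (`|mu| ^+ 2) * q 0 0 < 1 * q 0 0.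
  have e4 : 2 * mu * (2 * mu)^* = 4 * `|mu| ^+ 2.
    by rewrite -normCK normrM exprMn ger0_norm // -natrX.
  by rewrite mul1r -(@ltr_pM2l _ 4) ?ltr0n // mulrA -e4 e gtrBl.
by rewrite ltr_pM2r // expr_lt1.
Qed.

End TwoSymmetries.

(** * Invariance and bounds for the spectrum of V J *)

Section ThreeSymmetries.
Variables (C : numClosedFieldType) (n : nat) (E J J1 J2 : 'M[C]_n) (a b : C).
Let V := ((a + b) / 2)%:M + ((a - b) / 2) *: E.
Let V' := ((a + b) / 2)%:M - ((a - b) / 2) *: E.
Let g := - (a * b).
Hypotheses (EE : E *m E = 1%:M) (Eh : E^t* = E).
Hypotheses (JJ : J *m J = 1%:M) (Jh : J^t* = J).
Hypotheses (J1J1 : J1 *m J1 = 1%:M) (J2J2 : J2 *m J2 = 1%:M).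
Hypotheses (a0 : a != 0) (b0 : b != 0) (ab : a != b).

Let T := E *m J - J *m E.
Let K := E *m J + J *m E.
Hypothesis Tinj : forall v : 'rV_n, v *m T = 0 -> v = 0.

(** [V] takes the values [a], [b] on the eigenspaces of [E] for 1 and -1, and [V'] takes them in the
    opposite order. *)
Lemma refl_comb_mul : V *m V' = (a * b)%:M.
Proof.
rewrite /V /V' mulmxDl !mulmxBr -!scalemxAl -!scalemxAr EE.
rewrite !mul_scalar_mx !mul_mx_scalar !scalerA.
by apply/matrixP => i j; rewrite !mxE; case: (i == j);
  rewrite ?mulr1n ?mulr0n; field.
Qed.

(* On the left eigenvector v, W + g W^-1 = V J - J V' = (a - b) / 2 K. *)
Lemma eigen_sum_lt (v : 'rV_n) y : v *m (V *m J) = y *: v -> v != 0 -> y != 0 ->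
  `|y + g / y| < `|a - b|.
Proof.
move=> vW v0 y0; have ab0 : a - b != 0 by rewrite subr_eq0.
suff vK : v *m K = (2 * ((y + g / y) / (a - b))) *: v.
  have := anticommutator_eigen_lt EE JJ Eh Jh Tinj vK v0.
  by rewrite normrM normfV ltr_pdivrMr ?normr_gt0 // mul1r.
have vJV' : v *m (J *m V') = (a * b / y) *: v.
  apply: (scalerI y0); rewrite scalemxAl -vW !mulmxA -(mulmxA _ J J) JJ mulmx1.
  by rewrite -mulmxA refl_comb_mul mul_mx_scalar scalerA mulrCA divff ?mulr1.
have : v *m (V *m J - J *m V') = (y + g / y) *: v.
  by rewrite mulmxBr vW vJV' -scalerBl /g mulNr.
have -> : V *m J - J *m V' = ((a - b) / 2) *: K.
  rewrite /V /V' mulmxDl mulmxBr -scalemxAl -scalemxAr mul_scalar_mx mul_mx_scalar.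
  by rewrite opprB addrC addrA subrK addrC -scalerDr.
rewrite -scalemxAr => /(congr1 (fun u => (2 / (a - b)) *: u)); rewrite !scalerA.
have -> : 2 / (a - b) * ((a - b) / 2) = 1 by field.
by rewrite scale1r => ->; congr (_ *: _); field; rewrite ab0 y0.
Qed.

Hypothesis VJ : V = J1 *m J2 *m J.
Let W := V *m J.

(* With S = J1 V T one has S W = g W S, because T E = - E T and T J = - J T. *)
Lemma twist_eigen_mul (v : 'rV_n) y : v *m W = y *: v -> v != 0 ->
  exists2 u : 'rV_n, u *m W = (g * y) *: u & u != 0.
Proof.
move=> vW v0; pose S := J1 *m V *m T.
have W12 : W = J1 *m J2 by rewrite /W VJ -mulmxA JJ mulmx1.
have J21 : J2 *m J1 *m V = J.
  by rewrite VJ !mulmxA -(mulmxA J2) J1J1 mulmx1 J2J2 mul1mx.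
have VTV : V *m T *m V = (a * b) *: T.
  (* Since [T] anticommutes with [E], moving it past [V] changes the sign of the [E] term. *)
  have TV : T *m V = V' *m T.
    have := commutator_antil J EE; rewrite /V /V' -/T; move: (T) => U UE.
    rewrite mulmxDr mulmxBl mul_mx_scalar mul_scalar_mx -scalemxAr -scalemxAl.
    by rewrite UE scalerN.
  by rewrite -mulmxA TV mulmxA refl_comb_mul mul_scalar_mx.
have SW : S *m W = g *: (W *m S).
  have -> : W *m S = J1 *m (J *m T).
    by rewrite W12 /S !mulmxA; congr (_ *m _); rewrite -!mulmxA (mulmxA J2) J21.
  rewrite /S /W -!mulmxA (mulmxA T) (mulmxA V (T *m V)) (mulmxA V T) VTV.
  rewrite -scalemxAl (commutator_anti E JJ) scalerN mulmxN -scalemxAr /g scaleNr //.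
have unitS : row_free S.
  rewrite row_free_unit !unitmx_mul; apply/andP; split; first (apply/andP; split).
  - by case: (mulmx1_unit J1J1).
  - case: (@mulmx1_unit _ _ V ((a * b)^-1 *: V')) => //.
    by rewrite -scalemxAr refl_comb_mul scale_scalar_mx mulVf // mulf_neq0.
  - by rewrite -row_free_unit; apply/inj_row_free.
exists (v *m S); last by rewrite mulmx_free_eq0.
by rewrite -mulmxA SW -scalemxAr mulmxA vW -scalemxAl scalerA.
Qed.

Lemma twist_eigen_inv (v : 'rV_n) y : v *m W = y *: v -> v != 0 -> y != 0 ->
  exists2 u : 'rV_n, u *m W = y^-1 *: u & u != 0.
Proof.
move=> vW v0 y0; have W12 : W = J1 *m J2 by rewrite /W VJ -mulmxA JJ mulmx1.
exists (v *m J1); last first.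
  by rewrite mulmx_free_eq0 // row_free_unit; case: (mulmx1_unit J1J1).
rewrite W12 -mulmxA (mulmxA J1) J1J1 mul1mx; apply: (scalerI y0).
rewrite scalerA divff // scale1r scalemxAl -vW W12 -mulmxA.
by rewrite -(mulmxA J1) J2J2 mulmx1.
Qed.

End ThreeSymmetries.

(** * From trivial M1 and M2 to an injective commutator *)

Section StandardDecomposition.
Variables (R : realType) (n : nat).
Implicit Types (P J H : 'M[R[i]]_n).

(** [proj_ortho H] fixes the rows of [P], which lie in [H], and kills those of [1%:M - P], which are
    orthogonal to [H]. *)
Lemma proj_ortho_eq P H : P *m P = P -> P^t* = P -> (H :=: P)%MS ->
  proj_ortho H = P.
Proof.
move=> PP Ph HP.
have -> : proj_ortho H = P *m proj_ortho H + (1%:M - P) *m proj_ortho H.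
  by rewrite -mulmxDl addrC subrK mul1mx.
rewrite proj_ortho_id ?HP // proj_ortho_0 ?addr0 //.
apply/orthomx1P; have /submxP[D ->] : (H <= P)%MS by rewrite HP.
by rewrite tCmxM Ph mulmxA mulmxBl mul1mx PP subrr mul0mx.
Qed.

Lemma sub_kerB (A : 'M[R[i]]_n) (c : R[i]) (x : 'rV_n) :
  (x <= ker (A - c%:M))%MS = (x *m A^T == c *: x).
Proof.
rewrite /ker linearB /= tr_scalar_mx; apply/sub_kermxP/eqP.
  by rewrite mulmxBr mul_mx_scalar => /eqP; rewrite subr_eq0 => /eqP.
by rewrite mulmxBr mul_mx_scalar => ->; rewrite subrr.
Qed.

(** A sum of subspaces vanishes iff each of them does. The row [x] encodes a column vector, whence
    the transposed compression. *)
Lemma rank_std_M0 P H J : P *m P = P -> P^t* = P -> P^T = P -> (H :=: P)%MS ->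
  (\rank (std_M H J) = 0%N <->
   forall (x : 'rV_n) e, e = 1 \/ e = -1 -> x *m P = x ->
     x *m (P *m J *m P)^T = e *: x -> x = 0).
Proof.
move=> PP Ph Pt HP.
have memH (x : 'rV_n) : (x <= H)%MS = (x *m P == x).
  rewrite HP; apply/idP/eqP => [/submxP[D ->]|<-]; last exact: submxMl.
  by rewrite -mulmxA PP.
rewrite /std_M /compression /orthproj (proj_ortho_eq PP Ph HP) Pt.
move: (P *m J *m P) => A; have -> : A + 1%:M = A - (-1)%:M.
  by rewrite raddfN opprK.
split=> [/eqP | h].
  rewrite mxrank_eq0 => /eqP M0 x e e1 xP xA; apply/eqP; rewrite -submx0 -M0.
  case: e1 xA => -> xA; [apply: (submx_trans _ (addsmxSl _ _))|
                         apply: (submx_trans _ (addsmxSr _ _))];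
  by rewrite sub_capmx memH sub_kerB xP xA !eqxx.
apply/eqP; rewrite mxrank_eq0 -submx0 addsmx_sub; apply/andP; split;
apply/rV_subP => x; rewrite sub_capmx memH sub_kerB => /andP[/eqP xP /eqP xA].
  by rewrite (h x 1) ?sub0mx //; left.
by rewrite (h x (-1)) ?sub0mx //; right.
Qed.

Variables (P1 P2 J : 'M[R[i]]_n).
Hypotheses (P11 : P1 *m P1 = P1) (P22 : P2 *m P2 = P2) (P12 : P1 + P2 = 1%:M).
Hypotheses (P1h : P1^t* = P1) (P2h : P2^t* = P2).
Hypotheses (P1t : P1^T = P1) (P2t : P2^T = P2).
Hypotheses (JJ : J *m J = 1%:M) (Jh : J^t* = J).

Let E := P1 - P2.

Lemma projs_mul0 : P1 *m P2 = 0 /\ P2 *m P1 = 0.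
Proof.
have -> : P2 = 1%:M - P1 by rewrite -P12 addrC addKr.
by rewrite mulmxBr mulmxBl mulmx1 mul1mx P11 subrr.
Qed.

Lemma diff_projs_sqr : E *m E = 1%:M.
Proof.
have [h1 h2] := projs_mul0.
by rewrite /E mulmxBl !mulmxBr P11 P22 h1 h2 subr0 sub0r opprK.
Qed.

(** The transpose of a Hermitian matrix is its entrywise conjugate. This links the left eigenvectors
    of the spectral arguments with the transposed convention of [std_M]. *)
Lemma eigen_compression_conj P (x : 'rV_n) (e : R[i]) : P^t* = P -> P^T = P ->
  e^* = e -> x *m (P *m J *m P) = e *: x ->
  map_mx Num.conj x *m (P *m J *m P)^T = e *: map_mx Num.conj x.
Proof.
move=> Ph Pt ee xA; have -> : (P *m J *m P)^T = map_mx Num.conj (P *m J *m P).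
  have : (P *m J *m P)^t* = P *m J *m P by rewrite !tCmxM Ph Jh mulmxA.
  by move=> {2}<-; apply/matrixP => i j; rewrite !mxE conjCK.
by rewrite -map_mxM xA map_mxZ /= ee.
Qed.

(** Since [E] acts as [eps] on the range of [P], the anticommutator K satisfies P K P = 2 eps P J P.
    As K commutes with [P], a nonzero [u *m P] would be an eigenvector of the compression for
    [eps * e], which is 1 or -1. *)
Lemma eigen_anticommutator_part P (eps e : R[i]) (u : 'rV_n) :
  eps = 1 \/ eps = -1 -> e = 1 \/ e = -1 ->
  P *m P = P -> P^t* = P -> P^T = P -> P *m E = eps *: P -> E *m P = eps *: P ->
  (forall (x : 'rV_n) e, e = 1 \/ e = -1 -> x *m P = x ->
        x *m (P *m J *m P)^T = e *: x -> x = 0) ->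
  (E *m J + J *m E) *m P = P *m (E *m J + J *m E) ->
  u *m (E *m J + J *m E) = (e *+ 2) *: u -> u *m P = 0.
Proof.
move=> eps1 e1 PP Ph Pt PE EP hP KP uK.
have cj (c : R[i]) : c = 1 \/ c = -1 -> c^* = c.
  by case=> ->; rewrite ?rmorphN rmorph1.
have ee1 : eps * e = 1 \/ eps * e = -1.
  by case: eps1 => ->; case: e1 => ->; rewrite ?mulN1r ?mul1r ?opprK; auto.
suff : map_mx Num.conj (u *m P) = 0.
  move=> /rowP z; apply/rowP => i; have := z i; rewrite !mxE => /eqP.
  by rewrite conjC_eq0 => /eqP.
apply: (hP _ (eps * e)) => //.
  have Pc : map_mx Num.conj P = P by rewrite -{1}Pt.
  by rewrite -{2}Pc -map_mxM -mulmxA PP.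
apply: eigen_compression_conj => //; first exact: cj.
have PKP : P *m (E *m J + J *m E) *m P = (eps *+ 2) *: (P *m J *m P).
  rewrite mulmxDr mulmxDl !mulmxA PE -(mulmxA _ E P) EP -!scalemxAl -!scalemxAr.
  by rewrite -scalerDl.
have eps0 : eps *+ 2 != 0.
  by case: eps1 => ->; rewrite ?mulNrn ?oppr_eq0 mulrn_eq0 oner_eq0.
apply: (scalerI eps0); rewrite scalemxAr -PKP scalerA.
have -> : eps *+ 2 * (eps * e) = e *+ 2.
  by case: eps1 => ->; rewrite ?mulN1r ?mul1r -mulr_natl; ring.
rewrite -KP -(mulmxA _ P P) PP KP mulmxA -(mulmxA u) PP -mulmxA -KP mulmxA.
by rewrite uK scalemxAl.
Qed.

(** By [eigen_anticommutator_part], neither 2 nor -2 is an eigenvalue of K = E J + J E. If v is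
    killed by the commutator, then v K^2 = 4 v, so K acts as -2 on v K - 2 v, which is therefore
    zero; then v K = 2 v forces v = 0. *)
Lemma commutator_inj :
  (forall (x : 'rV_n) e, e = 1 \/ e = -1 -> x *m P1 = x ->
     x *m (P1 *m J *m P1)^T = e *: x -> x = 0) ->
  (forall (x : 'rV_n) e, e = 1 \/ e = -1 -> x *m P2 = x ->
     x *m (P2 *m J *m P2)^T = e *: x -> x = 0) ->
  forall v : 'rV_n, v *m (E *m J - J *m E) = 0 -> v = 0.
Proof.
move=> h1 h2 v vT; pose K := E *m J + J *m E.
have [P120 P210] := projs_mul0.
have EP1 : E *m P1 = 1 *: P1 by rewrite /E mulmxBl P11 P210 subr0 scale1r.
have P1E : P1 *m E = 1 *: P1 by rewrite /E mulmxBr P11 P120 subr0 scale1r.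
have EP2 : E *m P2 = -1 *: P2 by rewrite /E mulmxBl P22 P120 sub0r scaleN1r.
have P2E : P2 *m E = -1 *: P2 by rewrite /E mulmxBr P22 P210 sub0r scaleN1r.
have KE : K *m E = E *m K := anticommutator_comm J diff_projs_sqr.
have two0 : (2 : R[i]) != 0 by rewrite pnatr_eq0.
have KP1 : K *m P1 = P1 *m K.
  have -> : P1 = 2^-1 *: (E + 1%:M).
    rewrite -P12 /E addrACA addNr addr0 -mulr2n -[P1 *+ 2]scaler_nat scalerA.
    by rewrite mulVf // scale1r.
  by rewrite -scalemxAr -scalemxAl (mulmxDr K) (mulmxDl E) KE mulmx1 mul1mx.
have KP2 : K *m P2 = P2 *m K.
  have -> : P2 = 1%:M - P1 by rewrite -P12 addrC addKr.
  by rewrite (mulmxBr K) (mulmxBl _ _ K) KP1 mulmx1 mul1mx.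
have Keig (u : 'rV_n) e : e = 1 \/ e = -1 -> u *m K = (e *+ 2) *: u -> u = 0.
  move=> e1 uK; rewrite -[u]mulmx1 -P12 mulmxDr.
  rewrite (eigen_anticommutator_part _ e1 P11 P1h P1t P1E EP1) //; last by left.
  rewrite (eigen_anticommutator_part _ e1 P22 P2h P2t P2E EP2) //; last by right.
  by rewrite addr0.
have vKK : v *m K *m K = 4 *: v.
  rewrite -mulmxA anticommutator_sqr ?diff_projs_sqr // (mulmxDr v) (mulmxA v).
  by rewrite vT mul0mx add0r mul_mx_scalar.
have vK : v *m K = 2 *: v.
  apply/eqP; rewrite -subr_eq0; apply/eqP; apply: (Keig _ (-1)); first by right.
  rewrite mulmxBl vKK -scalemxAl; move: (v *m K) => w.
  by apply/rowP => i; rewrite !mxE; ring.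
by apply: (Keig _ 1); [left | rewrite vK].
Qed.

End StandardDecomposition.

(** Dividing by g^k, of modulus 1, turns the eigenvalue bound at a power of [g] into the bound on
    odd powers in conditions (a) and (b). *)
Lemma norm_pair_pow (C : numClosedFieldType) (g : C) k : `|g| = 1 ->
  `|g ^+ k.+1 + g / g ^+ k.+1| = `|g ^+ (2 * k.+1 - 1) + 1|.
Proof.
move=> gnorm.
have g0 : g != 0 by rewrite -normr_eq0 gnorm oner_eq0.
have -> : (2 * k.+1 - 1 = k.+1 + k)%N by lia.
have -> : `|g ^+ (k.+1 + k) + 1| = `|(g ^+ (k.+1 + k) + 1) / g ^+ k|.
  by rewrite normf_div normrX gnorm expr1n divr1.
congr (`|_|); rewrite exprD mulrDl mulfK ?expf_neq0 // mul1r.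
by rewrite exprS; congr (_ + _); field; rewrite g0 expf_neq0.
Qed.

(** * The order of g, and sets of unit numbers stable under multiplication by g *)

Section RootsOfUnity.
Variables (C : numClosedFieldType) (n : nat) (g : C).
Hypotheses (n0 : (0 < n)%N).
Hypothesis gmin : forall i, (0 < i < n)%N -> g ^+ i <> -1 /\ g ^+ i <> 1.

(** The order of [g] divides 2n, is at least [n] by minimality, and is not [n] because -1 differs
    from 1; only 2n is left. *)
Lemma prim_root_expN1 : g ^+ n = -1 -> (n + n).-primitive_root g.
Proof.
move=> gn; have n20 : (0 < n + n)%N by lia.
have g2n : g ^+ (n + n) = 1 by rewrite exprD gn mulrNN mulr1.
have [m gm /dvdnP[k km]] := prim_order_exists n20 g2n.
have m0 := prim_order_gt0 gm.
have mn : (n <= m)%N.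
  rewrite leqNgt; apply/negP => mn.
  by have [] := gmin (_ : (0 < m < n)%N); rewrite ?m0 // (prim_expr_order gm).
have neq : m != n.
  apply/eqP => e; have := prim_expr_order gm; rewrite e gn => /eqP.
  by rewrite eq_sym -subr_eq0 opprK -(natrD _ 1 1) pnatr_eq0.
suff -> : (n + n)%N = m by [].
by case: k km => [|[|k]]; rewrite ?mulSn; nia.
Qed.

Lemma prim_root_exp1 : g ^+ n = 1 -> n.-primitive_root g.
Proof.
move=> gn; have [m gm mn] := prim_order_exists n0 gn.
suff -> : n = m by [].
have m0 := prim_order_gt0 gm; have := dvdn_leq n0 mn; rewrite leq_eqVlt.
case/predU1P => // lt.
by have [] := gmin (_ : (0 < m < n)%N); rewrite ?m0 // (prim_expr_order gm).
Qed.

(** For even [n], the power of [g] with exponent n/2 would be a square root of 1, against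
    minimality. *)
Lemma expr_eq1_odd : g ^+ n = 1 -> odd n.
Proof.
move=> gn; apply/negPn/negP => ev; have nE : n = (n./2 * 2)%N by lia.
have : (g ^+ n./2) ^+ 2 == 1 by rewrite -exprM -nE gn.
have hn : (0 < n./2 < n)%N by lia.
have [h1 h2] := gmin hn.
by rewrite sqrf_eq1 => /orP[] /eqP.
Qed.

(** [spec] abstracts the spectrum of V J, and [M] the number |alpha - beta|. *)
Variables (spec : C -> Prop) (M : C).
Hypothesis spec_mul : forall y, spec y -> spec (g * y).
Hypothesis spec_inv : forall y, spec y -> spec y^-1.
Hypothesis spec_norm : forall y, spec y -> `|y| = 1.
Hypothesis spec_bound : forall y, spec y -> `|y + g / y| < M.
Hypothesis gnorm : `|g| = 1.

Lemma spec_mulX y k : spec y -> spec (y * g ^+ k).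
Proof.
by move=> sy; elim: k => [|k IH]; rewrite ?mulr1 // exprS mulrCA; apply: spec_mul.
Qed.

(** The orbit of [y] under [g] has 2n elements, as many as [spec] can hold, so it contains 1/y and
    y^2 is a power of [g]. An odd exponent violates the bound; an even one makes [y] a power of [g]
    up to sign, and -1 = g^n. *)
Lemma spec_prim_root y : spec y -> (n + n).-primitive_root g -> M <= 2 ->
  (forall s : seq C, uniq s -> (forall x, x \in s -> spec x) -> (size s <= n +
    n)%N) ->
  forall k, spec (g ^+ k).
Proof.
move=> sy gprim M2 card; have g2n := prim_expr_order gprim.
have y0 : y != 0 by rewrite -normr_eq0 spec_norm // oner_eq0.
have g0 : g != 0 by rewrite -normr_eq0 gnorm oner_eq0.
(* Inverses of powers of [g] are written with natural exponents, so that [spec_mulX] can multiply by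
   them. *)
have gM h : g ^+ h * g ^+ ((n + n).-1 * h) = 1.
  rewrite -exprD -mulSn prednK; last lia.
  by rewrite exprM g2n expr1n.
pose s := [seq y * g ^+ k | k <- iota 0 (n + n)].
have : y^-1 \in s.
  apply/negPn/negP => ys; suff : (size (y^-1 :: s) <= n + n)%N.
    by rewrite /= size_map size_iota ltnn.
  apply: card => [|x].
    rewrite /= ys map_inj_in_uniq ?iota_uniq // => i j.
    rewrite !mem_iota /= => lti ltj /(mulfI y0) /eqP.
    by rewrite (eq_prim_root_expr gprim) !modn_small // => /eqP.
  rewrite inE => /predU1P[->|/mapP[k _ ->]]; first exact: spec_inv.
  exact: spec_mulX.
case/mapP => k; rewrite mem_iota /= => ltk yk.
have y2 : y ^+ 2 = g ^+ (n + n - k).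
  apply: (mulIf (_ : g ^+ k != 0)); first by rewrite expf_neq0.
  by rewrite -exprD subnK ?(ltnW ltk) // g2n expr2 -mulrA -yk divff.
move: (n + n - k)%N y2 => l; rewrite -(odd_double_half l) exprD -muln2 exprM.
move: l./2 => h; case: (odd l) => y2.
  (* An eigenvalue z with z ^+ 2 = g would give |z + g / z| = 2. *)
  have sz := spec_mulX ((n + n).-1 * h) sy; set z := y * _ in sz.
  have z2 : z ^+ 2 = g.
    by rewrite /z exprMn y2 expr1 -mulrA -exprMn gM expr1n mulr1.
  have := spec_bound sz; rewrite -{1}z2 expr2 mulfK ?normrM; last first.
    by rewrite -normr_eq0 spec_norm // oner_eq0.
  rewrite -mulr2n normrMn spec_norm // => /lt_le_trans /(_ M2).
  by rewrite ltxx.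
have [m ym] : exists m, y = g ^+ m.
  move/eqP: y2; rewrite expr0 mul1r eqf_sqr => /orP[] /eqP ->; first by exists h.
  have /eqP : (g ^+ n) ^+ 2 == 1 by rewrite -exprM muln2 -addnn g2n.
  move/eqP; rewrite sqrf_eq1 => /orP[] /eqP gn; last first.
    by exists (n + h)%N; rewrite exprD gn mulN1r.
  have := eq_prim_root_expr gprim n 0; rewrite gn expr0 eqxx mod0n modn_small.
    by case: (n) n0.
  by lia.
move=> j; have := spec_mulX (j + (n + n).-1 * m) sy.
by rewrite ym exprD mulrCA gM mulr1.
Qed.

(** Here z = y^2 g^i for some i. Choosing k with g^(i+1) = g^(2k), the element u = y g^k of [spec]
    satisfies u^2 = z g, so u + g/u = (z + 1) g/u. *)
Lemma spec_roots_bound y z : spec y -> odd n -> n.-primitive_root g ->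
  z ^+ n = y ^+ (n + n) -> `|z + 1| < M.
Proof.
move=> sy oddn gprim zn; have gn := prim_expr_order gprim.
have y1 := spec_norm sy.
have y0 : y != 0 by rewrite -normr_eq0 y1 oner_eq0.
have g0 : g != 0 by rewrite -normr_eq0 gnorm oner_eq0.
have [i zi] : {i : 'I_n | z / y ^+ 2 = g ^+ i}.
  apply: (prim_rootP gprim); rewrite expr_div_n zn -exprM mul2n addnn divff //.
  by rewrite expf_neq0.
(* As [n] is odd, one of i + 1 and i + 1 + n is even. *)
have [k gi] : exists k, g ^+ i.+1 = g ^+ (k + k).
  case: (boolP (odd i)) => oi; first by exists i.+1./2; congr (_ ^+ _); lia.
  exists (i.+1 + n)./2; rewrite (_ : (_ + _)%N = (i.+1 + n)%N); last by lia.
  by rewrite exprD gn mulr1.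
have sz := spec_mulX k sy; have := spec_bound sz; have := spec_norm sz.
set u := y * _; move=> u1; have u0 : u != 0 by rewrite -normr_eq0 u1 oner_eq0.
have -> : u + g / u = (z + 1) * (g / u).
  have -> : z = u ^+ 2 / g.
    apply: (mulIf g0); rewrite divfK // -[z](@divfK _ (y ^+ 2)) ?expf_neq0 //.
    by rewrite zi /u mulrAC -exprSr gi exprMn exprD expr2 mulrC.
  by field; rewrite u0 g0.
by rewrite normrM normf_div gnorm u1 divr1 mulr1.
Qed.

End RootsOfUnity.

(** * Angles on the unit circle and distances to 1 and -1 *)

Section CirclePoints.
Variable R : realType.
Implicit Types (t : R) (z w : R[i]).

Lemma expiD t u : expi (t + u) = expi t * expi u.
Proof.
rewrite /expi cosD sinD; apply/eqP; rewrite eq_complex /= eqxx /=.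
by rewrite addrC (mulrC (sin t)) eqxx.
Qed.

Lemma expiX t n : expi t ^+ n = expi (t *+ n).
Proof.
elim: n => [|n IH]; last by rewrite exprS IH mulrS expiD.
by rewrite mulr0n /expi cos0 sin0.
Qed.

Lemma norm_expiD1 t : `|expi t + 1| = (Num.sqrt (2 + 2 * cos t))%:C%C.
Proof.
rewrite normc_def /=; congr (Num.sqrt _)%:C%C; rewrite addr0.
have := cos2Dsin2 t; rewrite sqrrD; move=> /(canRL (addKr _)) ->; ring.
Qed.

Lemma norm_expiB1 t : `|expi t - 1| = (Num.sqrt (2 - 2 * cos t))%:C%C.
Proof.
rewrite normc_def /=; congr (Num.sqrt _)%:C%C; rewrite subr0.
have := cos2Dsin2 t; rewrite sqrrB; move=> /(canRL (addKr _)) ->; ring.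
Qed.

Lemma ler_norm_expiD1 t u : cos t <= cos u -> `|expi t + 1| <= `|expi u + 1|.
Proof.
move=> tu; rewrite !norm_expiD1 lecR ler_wsqrtr //.
by rewrite lerD2l ler_pM2l.
Qed.

Lemma circle_expi z : `|z| = 1 -> exists2 t, `|t| <= pi & z = expi t.
Proof.
case: z => x y; rewrite normc_def /= => /eqP; rewrite eq_complex /= eqxx andbT.
move=> /eqP h; have xy : x ^+ 2 + y ^+ 2 = 1.
  by rewrite -[LHS]sqr_sqrtr ?h ?expr1n // addr_ge0 ?sqr_ge0.
have x1 : -1 <= x <= 1.
  by rewrite -ler_norml -(@expr_le1 _ 2) // real_normK ?num_real // -xy lerDl
    sqr_ge0.
have sx : Num.sqrt (1 - x ^+ 2) = `|y|.
  by rewrite -xy addrC addKr sqrtr_sqr.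
have ac : `|acos x| <= pi by rewrite ger0_norm ?acos_ge0 // acos_lepi.
case: (lerP 0 y) => y0; [exists (acos x) | exists (- acos x)]; rewrite ?normrN //;
by rewrite /expi ?cosN ?sinN acosK ?in_itv // sin_acos // sx
  ?(ger0_norm y0) ?(ltr0_norm y0) ?opprK.
Qed.

Lemma ler_cos : {in `[0, pi] &, {mono (@cos R) : x y /~ y <= x}}.
Proof. by move=> x y xpi ypi; rewrite leNgt ltr_cos // -leNgt. Qed.

Variable n : nat.
Hypothesis n0 : (0 < n)%N.

Let nR0 : (0 : R) < n%:R. Proof. by rewrite ltr0n. Qed.

(** The angle on the left is pi - pi/n: the constant of condition (c) is also a distance to -1. *)
Lemma norm_expi_far :
  `|expi ((n%:R - 1) / n%:R * pi : R) - 1| = `|expi (pi / n%:R : R) + 1|.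
Proof.
have -> : (n%:R - 1) / n%:R * pi = - (pi / n%:R) + pi :> R.
  by field; rewrite lt0r_neq0.
by rewrite norm_expiB1 norm_expiD1 cosDpi cosN mulrN opprK.
Qed.

Lemma pi_div_itv : pi / n%:R \in `[0, pi : R].
Proof.
rewrite in_itv /= divr_ge0 ?pi_ge0 ?(ltW nR0) //=.
by rewrite ler_pdivrMr // ler_peMr ?pi_ge0 // ler1n.
Qed.

(** Dividing by [n] an angle of [w] in [-pi, pi] gives a root within angle pi/n of 1, hence at least
    as far from -1 as the point of angle pi/n. *)
Lemma circle_root_near w : `|w| = 1 ->
  exists2 z, z ^+ n = w &
    `|expi ((n%:R - 1) / n%:R * pi : R) - 1| <= `|z + 1|.
Proof.
move=> /circle_expi[t tpi ->]; exists (expi (t / n%:R)).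
  by rewrite expiX -[_ *+ n]mulr_natr divfK // lt0r_neq0.
rewrite norm_expi_far; apply: ler_norm_expiD1.
rewrite -(cos_norm (t / _)) normrM normfV (ger0_norm (ltW nR0)).
rewrite ler_cos ?pi_div_itv //; first by rewrite ler_pM2r ?invr_gt0.
rewrite in_itv /= divr_ge0 ?(ltW nR0) //= ler_pdivrMr //.
by apply: le_trans tpi _; rewrite ler_peMr ?pi_ge0 // ler1n.
Qed.

(** An [n]-th root of -1 has an angle t with |t| at least pi/n: otherwise n |t| < pi and cos (n t) >
    -1. *)
Lemma rootN1_far z : z ^+ n = -1 ->
  `|z + 1| <= `|expi ((n%:R - 1) / n%:R * pi : R) - 1|.
Proof.
move=> zn; have z1 : `|z| = 1.
  apply/eqP; rewrite -(@pexpr_eq1 _ _ n) // -normrX zn normrN1 //.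
have [t tpi zt] := circle_expi z1.
rewrite norm_expi_far zt; apply: ler_norm_expiD1; rewrite -(cos_norm t).
have tin : `|t| \in `[0, pi : R] by rewrite in_itv /= normr_ge0.
rewrite ler_cos ?pi_div_itv // leNgt ltr_pdivlMr //; apply/negP => tn.
have : cos pi < cos (`|t| * n%:R).
  rewrite ltr_cos // in_itv /= ?lexx ?pi_ge0 //.
  by rewrite mulr_ge0 ?(ltW nR0) // ltW.
rewrite -(ger0_norm (ltW nR0)) -normrM cos_norm mulr_natr cospi.
move: zn; rewrite zt expiX => /eqP; rewrite eq_complex /= => /andP[/eqP -> _].
by rewrite ltxx.
Qed.

End CirclePoints.

(** * Unitary matrices with simple, conjugation-stable spectrum as products of two symmetries *)

Section SimpleSpectrum.
Variable C : numClosedFieldType.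

Lemma conjC_circle (z : C) : `|z| = 1 -> z^* = z^-1.
Proof.
move=> z1; have z0 : z != 0 by rewrite -normr_eq0 z1 oner_eq0.
by apply: (mulfI z0); rewrite -normCK z1 expr1n divff.
Qed.

(** The polynomial X^m - e is separable: modulo its derivative, a multiple of X^(m-1), it reduces to
    the nonzero constant -e. *)
Lemma Xn_sub_roots m (e : C) : (0 < m)%N -> e != 0 ->
  exists r : seq C, [/\ uniq r, size r = m & forall z, z \in r -> z ^+ m = e].
Proof.
move=> m0 e0; have [r pr] := closed_field_poly_normal ('X^m - e%:P : {poly C}).
have pm : 'X^m - e%:P \is monic by rewrite monicXnsubC.
move: pr; rewrite (monicP pm) scale1r => pr; exists r; split.
- rewrite -separable_prod_XsubC -pr unlock derivB derivXn derivC subr0.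
  case: m m0 {pm pr} => // m _; have mC : (m.+1%:R : C) != 0 by rewrite pnatr_eq0.
  rewrite -scaler_nat coprimepZr //= exprS coprimep_sym coprimep_addl_mul.
  by rewrite -polyCN -alg_polyC coprimepZr ?coprimep1 // oppr_eq0.
- by have := size_XnsubC e m0; rewrite pr size_prod_XsubC => -[].
- by move=> z; rewrite -root_prod_XsubC -pr rootE !hornerE subr_eq0 => /eqP.
Qed.

Variables (m : nat) (W : 'M[C]_m) (e : C).
Hypotheses (m0 : (0 < m)%N) (WW : W *m W^t* = 1%:M) (e1 : `|e| = 1) (er : e^* = e).
Hypothesis Weig : forall z, z ^+ m = e -> eigenvalue W z.

(** By counting, the diagonal entries of [D] are exactly the [m] distinct roots of z^m = e, a set
    closed under conjugation as [e] is real. The permutation matrix [Q] pairing conjugate entries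
    intertwines [D] with its adjoint, so [Q] and [Q *m D] are symmetries, with product [D]. *)
Lemma unitary_prod_symmetries : exists J1 J2 : 'M[C]_m,
  [/\ J1^t* = J1, J1 *m J1 = 1%:M, J2^t* = J2, J2 *m J2 = 1%:M & W = J1 *m J2].
Proof.
have WWt : W^t* *m W = 1%:M by apply: mulmx1C.
have /orthomx_spectralP : W \is normalmx by apply/normalmxP; rewrite WW WWt.
have := spectral_unitarymx W; move: (spectralmx W) (spectral_diag W) => U d Uu.
rewrite (invmx_unitary Uu) => WE.
have UU : U *m U^t* = 1%:M by apply/unitarymxP.
have UUt := mulmx1C UU.
have e0 : e != 0 by rewrite -normr_eq0 e1 oner_eq0.
have [r [ru rm rz]] := Xn_sub_roots m0 e0.
have eig z : z ^+ m = e -> z \in codom (d 0).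
  move=> /Weig /eigenvalueP[v vW v0].
  have : (v *m U^t*) *m diag_mx d = z *: (v *m U^t*).
    by rewrite scalemxAl -vW WE !mulmxA -(mulmxA _ U) UU mulmx1.
  have : v *m U^t* != 0.
    apply: contra v0 => /eqP h; rewrite -[v]mulmx1 -UUt mulmxA h.
    by rewrite mul0mx.
  move: (v *m _) => u; rewrite mul_mx_diag => /rV0Pn[i ui] /rowP /(_ i).
  by rewrite !mxE mulrC => /(mulIf ui) <-; exact: codom_f.
have sub : {subset r <= codom (d 0)} by move=> z /rz /eig.
have sz : (size (codom (d 0%R)) <= size r)%N by rewrite size_codom card_ord rm.
have dinj : injective (d 0).
  by apply/injectiveP; exact: leq_size_uniq ru sub sz.
have [_ mem] := uniq_min_size ru sub sz.
have dr i : (d 0 i) ^+ m = e by apply: rz; rewrite mem codom_f.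
have dn i : `|d 0 i| = 1.
  by apply/eqP; rewrite -(@pexpr_eq1 _ _ m) // -normrX dr e1.
have /fin_all_exists[p pd] i : exists k, d 0 k = (d 0 i)^*.
  have : (d 0 i)^* \in codom (d 0) by apply: eig; rewrite -rmorphXn /= dr er.
  by case/codomP => k ->; exists k.
have pp : involutive p by move=> i; apply: dinj; rewrite !pd conjCK.
pose Q : 'M[C]_m := rowsub p 1%:M; pose D := diag_mx d.
have Qmul (A : 'M[C]_m) : Q *m A = rowsub p A by rewrite mul_rowsub_mx mul1mx.
have Qh : Q^t* = Q.
  apply/matrixP => i k; rewrite !mxE /= rmorph_nat; congr (_ *+ _).
  by rewrite -(inj_eq (inv_inj pp)) pp eq_sym.
have QQ : Q *m Q = 1%:M by rewrite Qmul; apply/matrixP => i k; rewrite !mxE pp.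
have QD : Q *m D = D^t* *m Q.
  rewrite tr_diag_mx map_diag_mx Qmul mul_diag_mx; apply/matrixP => i k.
  rewrite !mxE pd /=.
  by case: (p i == k); rewrite ?mulr1n ?mulr1 ?mulr0n ?mulr0.
have DD : D^t* *m D = 1%:M.
  rewrite tr_diag_mx map_diag_mx mul_diag_mx; apply/matrixP => i k.
  rewrite !mxE; case: (i == k); last by rewrite mulr0n mulr0.
  by rewrite mulrC -normCK dn expr1n.
have Sh : (Q *m D)^t* = Q *m D by rewrite tCmxM Qh -QD.
have SS : Q *m D *m (Q *m D) = 1%:M.
  by rewrite {1}QD -mulmxA (mulmxA Q) QQ mul1mx DD.
have conj_mul (A B : 'M[C]_m) :
    U^t* *m A *m U *m (U^t* *m B *m U) = U^t* *m (A *m B) *m U.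
  by rewrite !mulmxA -(mulmxA _ U) UU mulmx1.
exists (U^t* *m Q *m U), (U^t* *m (Q *m D) *m U); split.
- by rewrite !tCmxM trmxCK Qh mulmxA.
- by rewrite conj_mul QQ mulmx1.
- by rewrite tCmxM tCmxM Sh trmxCK mulmxA.
- by rewrite conj_mul SS mulmx1.
- by rewrite conj_mul (mulmxA Q) QQ mul1mx.
Qed.

End SimpleSpectrum.

(** * The two coordinate projections and V in terms of them *)

Section CoordinateProjections.
Variables (C : numClosedFieldType) (n : nat).

Definition projl : 'M[C]_(n + n) := block_mx 1%:M 0 0 0.
Definition projr : 'M[C]_(n + n) := block_mx 0 0 0 1%:M.

Lemma projlK : projl *m projl = projl.
Proof. by rewrite mulmx_block !mulmx0 !mul0mx !addr0 mulmx1. Qed.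

Lemma projrK : projr *m projr = projr.
Proof. by rewrite mulmx_block !mulmx0 !mul0mx !add0r mulmx1. Qed.

Lemma projlDr : projl + projr = 1%:M.
Proof. by rewrite add_block_mx !addr0 add0r -scalar_mx_block. Qed.

Lemma tr_projl : projl^T = projl.
Proof. by rewrite tr_block_mx !trmx0 trmx1. Qed.

Lemma tr_projr : projr^T = projr.
Proof. by rewrite tr_block_mx !trmx0 trmx1. Qed.

Lemma projl_herm : projl^t* = projl.
Proof. by rewrite tr_projl map_block_mx !map_mx0 map_mx1. Qed.

Lemma projr_herm : projr^t* = projr.
Proof. by rewrite tr_projr map_block_mx !map_mx0 map_mx1. Qed.

Lemma projl_compression (A B D F : 'M[C]_n) :
  projl *m block_mx A B D F *m projl = block_mx A 0 0 0.
Proof. by rewrite !mulmx_block !(mulmx0, mul0mx, addr0, add0r, mul1mx, mulmx1). Qed.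

Lemma projr_compression (A B D F : 'M[C]_n) :
  projr *m block_mx A B D F *m projr = block_mx 0 0 0 F.
Proof. by rewrite !mulmx_block !(mulmx0, mul0mx, addr0, add0r, mul1mx, mulmx1). Qed.

Lemma block_scalar_refl (a b : C) : block_mx a%:M 0 0 b%:M =
  ((a + b) / 2)%:M + ((a - b) / 2) *: (projl - projr).
Proof.
rewrite opp_block_mx add_block_mx scale_block_mx [X in X + _]scalar_mx_block.
rewrite add_block_mx !oppr0 !addr0 sub0r !scaler0 !addr0 scalerN.
by congr block_mx; apply/matrixP => i k; rewrite !mxE; case: (i == k);
  rewrite ?mulr1n ?mulr0n; field.
Qed.

Lemma block_scalar_subl (a b : C) :
  block_mx a%:M 0 0 b%:M - a%:M = (b - a) *: projr.
Proof.
rewrite [X in _ - X]scalar_mx_block opp_block_mx add_block_mx scale_block_mx.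
by rewrite !scaler0 !subrr -raddfB scalemx1.
Qed.

Lemma block_scalar_subr (a b : C) :
  block_mx a%:M 0 0 b%:M - b%:M = (a - b) *: projl.
Proof.
rewrite [X in _ - X]scalar_mx_block opp_block_mx add_block_mx scale_block_mx.
by rewrite !scaler0 !subrr -raddfB scalemx1.
Qed.

Lemma eigen_diag_lt1 (f : 'I_n -> C) (x : 'rV_n) (e : C) :
  e = 1 \/ e = -1 -> (forall j, `|f j| < 1) ->
  x *m diag_mx (\row_j f j) = e *: x -> x = 0.
Proof.
move=> e1 f1; rewrite mul_mx_diag => /rowP h; apply/rowP => j.
have := h j; rewrite !mxE mulrC => /eqP; rewrite -subr_eq0 -mulrBl mulf_eq0.
case/orP => /eqP // /eqP; rewrite subr_eq0 => /eqP fe; have := f1 j.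
by rewrite fe; case: e1 => ->; rewrite ?normrN normr1 ltxx.
Qed.

End CoordinateProjections.

(** * A symmetry J giving V J prescribed eigenvalues *)

Section BlockReflection.
Variables (C : numClosedFieldType) (n : nat) (a b : C) (y : 'I_n -> C).
Let g := - (a * b).
Hypotheses (n0 : (0 < n)%N) (a1 : `|a| = 1) (b1 : `|b| = 1) (ab : a != b).
Hypotheses (y1 : forall j, `|y j| = 1).
Hypothesis ylt : forall j, `|y j + g / y j| < `|a - b|.

Let a0 : a != 0. Proof. by rewrite -normr_eq0 a1 oner_eq0. Qed.
Let b0 : b != 0. Proof. by rewrite -normr_eq0 b1 oner_eq0. Qed.
Let y0 j : y j != 0. Proof. by rewrite -normr_eq0 y1 oner_eq0. Qed.
Let ab0 : a - b != 0. Proof. by rewrite subr_eq0. Qed.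

(** Chosen so that [y j] and [g / y j] are the roots of z^2 - (a - b) c z - a b, the characteristic
    polynomial of V J on the [j]-th coordinate pair. *)
Definition refl_cos j : C := (y j - a * b / y j) / (a - b).
Definition refl_sin j : C := sqrtC (1 - refl_cos j ^+ 2).

(** Conjugation inverts [a], [b] and [y j], which multiplies both numerator and denominator by -1/(a
    b). *)
Lemma refl_cos_real j : (refl_cos j)^* = refl_cos j.
Proof.
rewrite /refl_cos rmorphM fmorphV !rmorphB !rmorphM fmorphV /=.
rewrite !(conjC_circle (y1 j)) (conjC_circle a1) (conjC_circle b1) invrK.
have ba0 : b - a != 0 by rewrite subr_eq0 eq_sym.
by field; rewrite ab0 a0 b0 y0 mulN1r ba0.
Qed.

Lemma refl_cos_lt1 j : `|refl_cos j| < 1.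
Proof.
rewrite normrM normfV ltr_pdivrMr ?normr_gt0 // mul1r.
by have := ylt j; rewrite /g mulNr.
Qed.

Lemma refl_sin_sqr j : refl_sin j ^+ 2 = 1 - refl_cos j ^+ 2.
Proof. exact: sqrtCK. Qed.

Let gap_gt0 j : 0 < 1 - refl_cos j ^+ 2.
Proof.
by rewrite subr_gt0 expr2 -{2}refl_cos_real -normCK expr_lt1 // refl_cos_lt1.
Qed.

Lemma refl_sin_neq0 j : refl_sin j != 0.
Proof. by rewrite -sqrf_eq0 refl_sin_sqr lt0r_neq0. Qed.

Lemma refl_sin_real j : (refl_sin j)^* = refl_sin j.
Proof. by apply/CrealP/ger0_real; rewrite sqrtC_ge0 ltW. Qed.

Let Dc := diag_mx (\row_j refl_cos j).
Let Ds := diag_mx (\row_j refl_sin j).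
Definition refl_mx : 'M[C]_(n + n) := block_mx Dc Ds Ds (- Dc).

Lemma refl_mx_herm : refl_mx^t* = refl_mx.
Proof.
have h (f : 'I_n -> C) : (forall j, (f j)^* = f j) ->
    (diag_mx (\row_j f j))^t* = diag_mx (\row_j f j).
  move=> fr; rewrite tr_diag_mx map_diag_mx; congr diag_mx.
  by apply/rowP => j; rewrite !mxE; exact: fr.
rewrite /refl_mx tr_block_mx map_block_mx linearN /= map_mxN.
by rewrite !h //; [exact: refl_sin_real | exact: refl_cos_real].
Qed.

Lemma refl_mx_sqr : refl_mx *m refl_mx = 1%:M.
Proof.
rewrite /refl_mx mulmx_block [RHS]scalar_mx_block !mulmxN !mulNmx opprK.
have e1 : Dc *m Dc + Ds *m Ds = 1%:M.
  rewrite !mul_diag_mx; apply/matrixP => i k; rewrite !mxE.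
  case: (i == k); rewrite ?mulr1n ?mulr0n ?mulr0 ?addr0 //.
  by have := refl_sin_sqr i; rewrite !expr2 => ->; rewrite subrKC.
have e2 : Dc *m Ds = Ds *m Dc by exact: diag_mxC.
by rewrite e1 e2 !subrr addrC e1.
Qed.

Lemma refl_mx_tr : \tr refl_mx = 0.
Proof. by rewrite mxtrace_block raddfN /= subrr. Qed.

(** The diagonal blocks of [refl_mx] are diagonal with entries of modulus below 1, so neither has
    eigenvalue 1 or -1; with the next lemma this yields M1 = M2 = 0. *)
Lemma refl_mx_compressionl (x : 'rV_(n + n)) (c : C) : c = 1 \/ c = -1 ->
  x *m projl C n = x -> x *m (projl C n *m refl_mx *m projl C n)^T = c *: x ->
  x = 0.
Proof.
move=> c1; rewrite -[x]hsubmxK; move: (lsubmx x) (rsubmx x) => x1 x2.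
rewrite {1}/projl mul_row_block !mulmx0 !addr0 mulmx1 => /eq_row_mx[_ <-].
rewrite projl_compression.
rewrite tr_block_mx !trmx0 tr_diag_mx mul_row_block !mulmx0 !addr0.
rewrite scale_row_mx => /eq_row_mx[/(eigen_diag_lt1 c1 refl_cos_lt1) -> _].
by rewrite row_mx0.
Qed.

Lemma refl_mx_compressionr (x : 'rV_(n + n)) (c : C) : c = 1 \/ c = -1 ->
  x *m projr C n = x -> x *m (projr C n *m refl_mx *m projr C n)^T = c *: x ->
  x = 0.
Proof.
move=> c1; rewrite -[x]hsubmxK; move: (lsubmx x) (rsubmx x) => x1 x2.
rewrite {1}/projr mul_row_block !mulmx0 !add0r mulmx1 => /eq_row_mx[<- _].
rewrite projr_compression tr_block_mx !trmx0 mul_row_block !mulmx0 !add0r.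
rewrite [(- Dc)^T]raddfN /= tr_diag_mx mulmxN scale_row_mx => /eq_row_mx[_ h].
suff -> : x2 = 0 by rewrite row_mx0.
apply: (eigen_diag_lt1 (e := - c) _ refl_cos_lt1); last by rewrite scaleNr -h opprK.
by case: c1 => ->; rewrite ?opprK; auto.
Qed.

Lemma refl_eigen j z : z ^+ 2 - (a - b) * refl_cos j * z - a * b = 0 ->
  eigenvalue (block_mx a%:M 0 0 b%:M *m refl_mx) z.
Proof.
move=> hz; apply/eigenvalueP.
pose dj : 'rV[C]_n := delta_mx 0 j.
(* This is a left eigenvector of the 2 x 2 block with rows (a c, a s) and (b s, -b c); it is nonzero
   because s is. *)
exists (row_mx ((b * refl_sin j) *: dj) ((z - a * refl_cos j) *: dj)); last first.
  apply/eqP; rewrite -row_mx0 => /eq_row_mx[/rowP /(_ j) /eqP + _].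
  by apply/negP; rewrite !mxE !eqxx mulr1 mulf_neq0 // refl_sin_neq0.
have dD (f : 'I_n -> C) : dj *m diag_mx (\row_j f j) = f j *: dj.
  by rewrite -rowE row_diag_mx mxE.
rewrite mulmxA mul_row_block !mulmx0 addr0 add0r !mul_mx_scalar.
rewrite mul_row_block !mulmxN -!scalemxAl !dD scale_row_mx !scalerA -scaleNr
  -!scalerDl.
have s2 := refl_sin_sqr j.
congr row_mx; congr (_ *: _); first by ring.
have -> : z * (z - a * refl_cos j) = z ^+ 2 - (a - b) * refl_cos j * z - a * b
   + a * b - b * refl_cos j * z by ring.
rewrite hz.
have -> : a * (b * refl_sin j) * refl_sin j = a * b * refl_sin j ^+ 2 by ring.
by rewrite s2; ring.
Qed.

Lemma refl_eigen_l j : eigenvalue (block_mx a%:M 0 0 b%:M *m refl_mx) (y j).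
Proof.
apply: (@refl_eigen j); rewrite /refl_cos; field; by rewrite ab0 y0.
Qed.

Lemma refl_eigen_r j : eigenvalue (block_mx a%:M 0 0 b%:M *m refl_mx) (g / y j).
Proof.
apply: (@refl_eigen j); rewrite /refl_cos /g; field; by rewrite ab0 y0.
Qed.

Variable e : C.
Hypotheses (e1 : `|e| = 1) (er : e^* = e).
Hypothesis ycov : forall z, z ^+ (n + n) = e -> exists j, z = y j \/ z = g / y j.

Lemma refl_mx_factor : exists J1 J2 : 'M[C]_(n + n),
  [/\ J1^t* = J1, J1 *m J1 = 1%:M, J2^t* = J2, J2 *m J2 = 1%:M
    & block_mx a%:M 0 0 b%:M = J1 *m J2 *m refl_mx].
Proof.
pose V : 'M[C]_(n + n) := block_mx a%:M 0 0 b%:M.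
have VV : V *m V^t* = 1%:M.
  rewrite /V tr_block_mx map_block_mx !trmx0 !map_mx0 !tr_scalar_mx !map_scalar_mx.
  rewrite mulmx_block !mulmx0 !mul0mx !addr0 add0r -!scalar_mxM -!normCK a1 b1.
  by rewrite !expr1n -scalar_mx_block.
have [||||z zn|J1 [J2 [h1 h2 h3 h4 WE]]] :=
    @unitary_prod_symmetries C _ (V *m refl_mx) e.
- by rewrite addn_gt0 n0.
- by rewrite tCmxM mulmxA -(mulmxA V) refl_mx_herm refl_mx_sqr mulmx1.
- exact: e1.
- exact: er.
- by case: (ycov zn) => j [] ->; [exact: refl_eigen_l | exact: refl_eigen_r].
exists J1, J2; split=> //.
by rewrite -WE -mulmxA refl_mx_sqr mulmx1.
Qed.

End BlockReflection.

(** * Condition (P) in terms of g, and both directions of the equivalence *)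

Section Final.
Variable R : realType.

Lemma symmetryP n (J : 'M[R[i]]_n) :
  symmetry J <-> J^t* = J /\ J *m J = 1%:M.
Proof.
split=> [[Ju Jh Ji]|[Jh JJ]]; first by split; [rewrite -Jh | rewrite {2}Ji mulmxV].
have [Ju _] := mulmx1_unit JJ; split=> //.
by rewrite -[RHS]mulmx1 -JJ mulKmx.
Qed.

Lemma ker_scale_proj n (P1 P2 : 'M[R[i]]_n) (c : R[i]) : c != 0 ->
  P1 *m P1 = P1 -> P1 + P2 = 1%:M -> P2^T = P2 -> (ker (c *: P2) :=: P1)%MS.
Proof.
move=> c0 P11 P12 P2t; have e2 : P2 = 1%:M - P1 by rewrite -P12 addrC addKr.
rewrite /ker linearZ /= P2t; apply/eqmxP/andP; split; apply/rV_subP => v.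
  move/sub_kermxP; rewrite -scalemxAr e2 mulmxBr mulmx1 => /eqP.
  by rewrite scaler_eq0 (negPf c0) subr_eq0 => /eqP ->; exact: submxMl.
move=> /submxP[D ->]; apply/sub_kermxP.
by rewrite -scalemxAr e2 mulmxBr mulmx1 -mulmxA P11 subrr scaler0.
Qed.

Variables (n : nat) (a b : R[i]).
Hypotheses (n2 : (1 < n)%N) (P : conditionP n n a b).
Let n0 : (0 < n)%N. Proof. exact: ltnW. Qed.
Let g := - (a * b).
Let V : 'M[R[i]]_(n + n) := block_mx a%:M 0 0 b%:M.
Let H1 := ker (V - a%:M).
Let H2 := ker (V - b%:M).

Let a1 : `|a| = 1. Proof. exact: condP_alpha P. Qed.
Let b1 : `|b| = 1. Proof. exact: condP_beta P. Qed.
Let ab : a != b. Proof. by apply/eqP; exact: condP_neq P. Qed.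
Let g1 : `|g| = 1. Proof. by rewrite normrN normrM a1 b1 mulr1. Qed.

Lemma powg_pm1 i : g ^+ i = -1 \/ g ^+ i = 1 <->
  a ^+ i * b ^+ i = -1 \/ a ^+ i * b ^+ i = 1.
Proof.
rewrite -exprMn /g exprNn -signr_odd; case: (odd i); last by rewrite expr0 mul1r.
rewrite expr1 mulN1r; split=> -[] /eqP.
- by rewrite eqr_opp => /eqP; right.
- by rewrite eqr_oppLR => /eqP; left.
- by move/eqP => ->; right; rewrite opprK.
- by move/eqP => ->; left.
Qed.

(** This is clause (ii) of Condition (P) at equal exponents. *)
Lemma condP_gmin i : (0 < i < n)%N -> g ^+ i <> -1 /\ g ^+ i <> 1.
Proof.
move=> lti; have h := condP_min P (i := i) (j := i).
by split=> e; suff : (n + n <= i + i)%N by [lia]; apply: h; try lia;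
  apply/powg_pm1; [left|right].
Qed.

Lemma condP_gn : g ^+ n = -1 \/ g ^+ n = 1.
Proof. by apply/powg_pm1; exact: condP_det P. Qed.

Lemma gap_le2 : `|a - b| <= 2.
Proof. by rewrite (le_trans (ler_normB _ _)) // a1 b1. Qed.

Lemma kerl : (H1 :=: projl _ n)%MS.
Proof.
rewrite /H1 /V block_scalar_subl; apply: ker_scale_proj.
- by rewrite subr_eq0 eq_sym.
- exact: projlK.
- exact: projlDr.
- exact: tr_projr.
Qed.

Lemma kerr : (H2 :=: projr _ n)%MS.
Proof.
rewrite /H2 /V block_scalar_subr; apply: ker_scale_proj.
- by rewrite subr_eq0.
- exact: projrK.
- by rewrite addrC; exact: projlDr.
- exact: tr_projl.
Qed.

Definition factorization := exists J1 J2 J : 'M[R[i]]_(n + n),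
      [/\ symmetry J1, symmetry J2 & symmetry J] /\
      [/\ V = J1 *m J2 *m J, balanced J,
          \rank (std_M H1 J) = 0%N & \rank (std_M H2 J) = 0%N].

Lemma pow_gap k : `|(a * b) ^+ (2 * k.+1 - 1) - 1| = `|g ^+ (2 * k.+1 - 1) + 1|.
Proof.
rewrite /g exprNn -signr_odd; have -> : odd (2 * k.+1 - 1) by lia.
by rewrite expr1 mulN1r distrC addrC.
Qed.

Lemma factorization_spec : factorization ->
  (g ^+ n = -1 /\ forall j, (1 <= j <= n)%N ->
      `|(a * b) ^+ (2 * j - 1) - 1| < `|a - b|) \/
  [/\ odd n, g ^+ n = 1 &
      `|expi ((n%:R - 1) / n%:R * pi : R) - 1| < `|a - b|].
Proof.
move=> [J1 [J2 [J [[/symmetryP[_ J1J1] /symmetryP[_ J2J2] /symmetryP[Jh JJ]]]]]].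
case=> VJ _.
move=> /(rank_std_M0 J (@projlK _ n) (@projl_herm _ n) (@tr_projl _ n) kerl) M1.
move=> /(rank_std_M0 J (@projrK _ n) (@projr_herm _ n) (@tr_projr _ n) kerr) M2.
pose E : 'M[R[i]]_(n + n) := projl _ n - projr _ n.
have EE : E *m E = 1%:M.
  by apply: diff_projs_sqr; [exact: projlK|exact: projrK|exact: projlDr].
have Eh : E^t* = E by rewrite tCmxB projl_herm projr_herm.
have Tinj := commutator_inj (@projlK _ n) (@projrK _ n) (@projlDr _ n)
  (@projl_herm _ n) (@projr_herm _ n) (@tr_projl _ n) (@tr_projr _ n) JJ Jh M1 M2.
have a0 : a != 0 by rewrite -normr_eq0 a1 oner_eq0.
have b0 : b != 0 by rewrite -normr_eq0 b1 oner_eq0.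
have VE := block_scalar_refl n a b; rewrite -/V -/E in VE.
pose spec (y : R[i]) := eigenvalue (V *m J) y.
have WW : V *m J *m (V *m J)^t* = 1%:M.
  rewrite tCmxM Jh mulmxA -(mulmxA V) JJ mulmx1.
  rewrite /V tr_block_mx map_block_mx !trmx0 !map_mx0 !tr_scalar_mx !map_scalar_mx.
  rewrite mulmx_block !mulmx0 !mul0mx !addr0 add0r -!scalar_mxM -!normCK a1 b1.
  by rewrite !expr1n -scalar_mx_block.
have spec_norm y : spec y -> `|y| = 1.
  by move=> /eigenvalueP[v vW v0]; exact: unitarymx_eigen_norm WW vW v0.
have spec_neq0 y : spec y -> y != 0.
  by move=> /spec_norm y1; rewrite -normr_eq0 y1 oner_eq0.
have spec_mul y : spec y -> spec (g * y).
  move=> /eigenvalueP[v vW v0]; apply/eigenvalueP; move: VJ vW; rewrite VE => VJ vW.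
  exact: (twist_eigen_mul EE JJ J1J1 J2J2 a0 b0 Tinj VJ vW v0).
have spec_inv y : spec y -> spec y^-1.
  move=> sy; have y0 := spec_neq0 _ sy; case/eigenvalueP: sy => v vW v0.
  apply/eigenvalueP; move: VJ vW; rewrite VE => VJ vW.
  exact: (twist_eigen_inv JJ J1J1 J2J2 VJ vW v0 y0).
have spec_bound y : spec y -> `|y + g / y| < `|a - b|.
  move=> sy; have y0 := spec_neq0 _ sy; case/eigenvalueP: sy => v vW v0.
  move: vW; rewrite VE => vW; exact: (eigen_sum_lt EE Eh JJ Jh ab Tinj vW v0 y0).
have card (s : seq R[i]) : uniq s -> (forall x, x \in s -> spec x) ->
    (size s <= n + n)%N.
  move=> us ss; rewrite -ltnS -(size_char_poly (V *m J)).
  apply: max_poly_roots => //; first by rewrite monic_neq0 // char_poly_monic.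
  by apply/allP => x /ss; rewrite /spec eigenvalue_root_char.
have [y sy] : exists y, spec y by apply: eigenvalue_closed; rewrite addn_gt0 n0.
have y1 := spec_norm _ sy.
case: condP_gn => gn; [left | right]; split=> //.
- have gprim := prim_root_expN1 n0 condP_gmin gn.
  have full := spec_prim_root n0 spec_mul spec_inv spec_norm spec_bound g1 sy gprim
    gap_le2 card.
  case=> // j _; rewrite pow_gap -(norm_pair_pow _ g1).
  exact: spec_bound (full j.+1).
- exact: expr_eq1_odd condP_gmin gn.
- have gprim := prim_root_exp1 n0 condP_gmin gn.
  (* Among the [n]-th roots of y^(2n), one close to 1 gives a bound at least as strong as the one in
     (c), whatever [y] is. *)
  have [|z zn zle] := @circle_root_near R n n0 (y ^+ (n + n)).
    by rewrite normrX y1 expr1n.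
  apply: (le_lt_trans zle).
  apply: (spec_roots_bound n0 spec_mul spec_norm spec_bound g1 sy _ gprim zn).
  exact: expr_eq1_odd condP_gmin gn.
Qed.

Lemma factorization_refl (y : 'I_n -> R[i]) (e : R[i]) :
  (forall j, `|y j| = 1) -> (forall j, `|y j + g / y j| < `|a - b|) ->
  `|e| = 1 -> e^* = e ->
  (forall z, z ^+ (n + n) = e -> exists j, z = y j \/ z = g / y j) ->
  factorization.
Proof.
move=> y1 ylt e1 er ycov.
have [J1 [J2 [h1 h2 h3 h4 VJ]]] := refl_mx_factor n0 a1 b1 ab y1 ylt e1 er ycov.
exists J1, J2, (refl_mx a b y); split; first split.
- by apply/symmetryP.
- by apply/symmetryP.
- by apply/symmetryP; split; [exact: refl_mx_herm | exact: refl_mx_sqr].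
split=> //; first by left; exact: refl_mx_tr.
- apply: (proj2 (rank_std_M0 (refl_mx a b y) (@projlK _ n) (@projl_herm _ n)
    (@tr_projl _ n) kerl)) => x c; exact: (refl_mx_compressionl ab ylt).
- apply: (proj2 (rank_std_M0 (refl_mx a b y) (@projrK _ n) (@projr_herm _ n)
    (@tr_projr _ n) kerr)) => x c; exact: (refl_mx_compressionr ab ylt).
Qed.

(** Here [g] has order 2n. The numbers g^(j+1) for j < n cover the exponents 1 to n, and their
    partners g^(-j) cover 0 and n + 1 to 2n - 1. *)
Lemma factorization_expN1 : g ^+ n = -1 ->
  (forall j, (1 <= j <= n)%N -> `|(a * b) ^+ (2 * j - 1) - 1| < `|a - b|) ->
  factorization.
Proof.
move=> gn lt; have gprim := prim_root_expN1 n0 condP_gmin gn.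
have g0 : g != 0 by rewrite -normr_eq0 g1 oner_eq0.
apply: (@factorization_refl (fun j => g ^+ j.+1) 1).
- by move=> j; rewrite normrX g1 expr1n.
- by move=> j; rewrite (norm_pair_pow _ g1) -pow_gap; apply: lt; rewrite /= ltn_ord.
- exact: normr1.
- exact: rmorph1.
move=> z /(prim_rootP gprim)[k ->].
have [k0|k0] := posnP k.
  by exists (Ordinal n0); right; rewrite k0 /= expr1 divff.
have [kn|kn] := leqP k n.
  have lt' : (k.-1 < n)%N by lia.
  by exists (Ordinal lt'); left; rewrite /= prednK.
have lt' : (n + n - k < n)%N by lia.
exists (Ordinal lt'); right; apply: (mulIf (_ : g ^+ (n + n - k).+1 != 0)).
  by rewrite expf_neq0.
rewrite /= divfK ?expf_neq0 // -exprD addnS subnKC ?(ltnW (ltn_ord k)) //.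
by rewrite exprS (prim_expr_order gprim) mulr1.
Qed.

Lemma factorization_exp1 : g ^+ n = 1 ->
  `|expi ((n%:R - 1) / n%:R * pi : R) - 1| < `|a - b| ->
  factorization.
Proof.
move=> gn lt; have gprim := prim_root_exp1 n0 condP_gmin gn.
have g0 : g != 0 by rewrite -normr_eq0 g1 oner_eq0.
(* l ^+ n = 'i or - 'i: the orbits of l and of its conjugate under g are
   disjoint and together form the roots of z ^+ (n + n) = -1. *)
pose l : R[i] := (n + n).-root (-1).
have ln : l ^+ (n + n) = -1 by apply: rootCK; rewrite addn_gt0 n0.
have l1 : `|l| = 1.
  by apply/eqP;
    rewrite -(@pexpr_eq1 _ _ (n + n)) ?addn_gt0 ?n0 // -normrX ln normrN1.
have l0 : l != 0 by rewrite -normr_eq0 l1 oner_eq0.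
have y1 j : `|l * g ^+ j| = 1 by rewrite normrM l1 normrX g1 expr1n mulr1.
apply: (@factorization_refl (fun j => l * g ^+ j) (-1)).
- by move=> j; exact: y1.
- move=> j; have := y1 j; set y := l * _ => yj.
  have y0 : y != 0 by rewrite -normr_eq0 yj oner_eq0.
  (* The number y^2/g is an [n]-th root of -1, so [rootN1_far] bounds its distance to -1. *)
  have -> : y + g / y = (y ^+ 2 / g + 1) * (g / y) by field; rewrite y0 g0.
  rewrite normrM normf_div g1 yj divr1 mulr1; apply: le_lt_trans lt.
  apply: (rootN1_far n0).
  rewrite expr_div_n gn divr1 -exprM mul2n -addnn exprMn ln -exprM mulnC exprM.
  by rewrite exprD gn mulr1 expr1n mulr1.
- exact: normrN1.
- by rewrite rmorphN rmorph1.
move=> z zn; have : (z ^+ n) ^+ 2 == (l ^+ n) ^+ 2.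
  by rewrite -!exprM muln2 -addnn zn ln.
rewrite eqf_sqr => /orP[] /eqP zl.
  have [|k zk] := (prim_rootP gprim) (z / l) _.
    by rewrite expr_div_n zl divff // expf_neq0.
  by exists k; left; rewrite -zk mulrC divfK.
(* Now z^n = -l^n, so (z l)^n = -l^(2n) = 1 and z l = g^k, that is z = g / (l g^(n+1-k)); the
   exponent is then reduced modulo [n]. *)
have [|k zk] := (prim_rootP gprim) (z * l) _.
  by rewrite exprMn zl mulNr -exprD ln opprK.
exists (Ordinal (ltn_pmod (n.+1 - k) n0)); right => /=.
have y0 : l * g ^+ (n.+1 - k) != 0 by rewrite mulf_neq0 // expf_neq0.
rewrite expr_mod //; apply: (mulIf y0); rewrite divfK // mulrA zk -exprD subnKC.
  by rewrite exprS gn mulr1.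
by rewrite ltnW // ltnS ltnW.
Qed.

End Final.

Theorem theorem3p22 (R : realType) (r s : nat) (alpha beta : R[i]) :
  let d := (r + s)%N in
  let d0 := (d %/ 2)%N in
  let V : 'M[R[i]]_d := block_mx alpha%:M 0 0 beta%:M in
  let H1 := ker (V - alpha%:M) in
  let H2 := ker (V - beta%:M) in
  (4 <= d)%N -> ~~ odd d -> r = s -> conditionP r s alpha beta ->
  ((Sym 3 V /\
    exists J1 J2 J : 'M[R[i]]_d,
      [/\ symmetry J1, symmetry J2 & symmetry J] /\
      [/\ V = J1 *m J2 *m J, balanced J,
          \rank (std_M H1 J) = 0%N & \rank (std_M H2 J) = 0%N])
   <->
   [\/ [/\ (4 %| d)%N, (alpha * beta) ^+ d0 = -1 &
           forall j : nat, (1 <= j <= d0)%N ->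
             `|(alpha * beta) ^+ (2 * j - 1) - 1| < `|alpha - beta|],
       ~~ (4 %| d)%N /\
         (forall j : nat, (1 <= j <= d0)%N ->
           `|(alpha * beta) ^+ (2 * j - 1) - 1| < `|alpha - beta|) |
       [/\ ~~ (4 %| d)%N, (- (alpha * beta)) ^+ d0 = 1 &
           `|expi ((d0%:R - 1) / d0%:R * pi : R) - 1| < `|alpha - beta|]]).
Proof.
move=> d d0 V H1 H2 d4 _ rs; subst s => P.
have n2 : (1 < r)%N by rewrite /d in d4; lia.
have -> : d0 = r by rewrite /d0 /d addnn -muln2 mulnK.
have -> : (4 %| d)%N = ~~ odd r by rewrite /d; lia.
have sgn : (- (alpha * beta)) ^+ r = (-1) ^+ odd r * (alpha * beta) ^+ r.
  by rewrite signr_odd -exprNn.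
split=> [[_ /(factorization_spec n2 P)] [[gn lt]|[oddr gn lt]] | h].
(* When g^r = -1, the parity of [r] decides between (a) and (b). *)
- case: (boolP (odd r)) => oddr; [by constructor 2 | constructor 1; split=> //].
  by rewrite -gn sgn (negPf oddr) expr0 mul1r.
- by constructor 3; split=> //; rewrite negbK.
suff fac : factorization r alpha beta.
  split; last exact: fac.
  have [J1 [J2 [J [[s1 s2 s3] [VJ _ _ _]]]]] := fac.
  exists (fun i => [:: J1; J2; J]`_i); split.
    by case=> -[|[|[|//]]].
  by rewrite !big_ord_recl big_ord0 /= mulmx1 mulmxA -VJ.
case: h => [[evenr gn lt]|[]|[_ gn lt]];
  last exact: (factorization_exp1 n2 P gn lt).
  apply: (factorization_expN1 n2 P) lt.
  by rewrite sgn (negPf evenr) expr0 mul1r.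
rewrite negbK => oddr lt; apply: (factorization_expN1 n2 P) => //.
(* Condition (b) excludes g^r = 1: then (alpha beta)^r = -1 as [r] is odd, and j = (r + 1)/2, for
   which 2j - 1 = r, would give 2 < |alpha - beta|. *)
case: (condP_gn P) => // gn; have := lt r.+1./2.
rewrite (_ : 2 * _ - 1 = r)%N; last by lia.
move: sgn; rewrite gn oddr expr1 mulN1r => /esym /eqP; rewrite eqr_oppLR => /eqP ->.
rewrite -opprD normrN ger0_norm ?addr_ge0 // => h.
have /h /lt_le_trans /(_ (gap_le2 P)) : (1 <= r.+1./2 <= r)%N by lia.
by rewrite ltxx.
Qed.
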